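(* Let $(A,B)$ be a pair of complex matrices of the same size. Apply the mixed-equivalence reduction algorithm (described in the context) to $(A,B)$ and obtain $$(k_1,l_1),\ (k_2,l_2),\ \dots,\ (k_t,l_t),\ (A_t,B_t).$$ Apply the same algorithm to the pair $(\underline A,\underline B):=(B_t^T,A_t^T)$ and obtain $$(\underline k_1,\underline l_1),\ (\underline k_2,\underline l_2),\ \dots,\ (\underline k_{\underline t},\underline l_{\underline t}),\ (\underline A_{\underline t},\underline B_{\underline t}).$$ Then $(A,B)$ is mixed equivalent to $$\begin{aligned} &(F_1,G_1)^{(k_1-l_1)}\oplus\dots\oplus(F_{t-1},G_{t-1})^{(k_{t-1}-l_{t-1})}\oplus(F_t,G_t)^{(k_t-l_t)}\\ \oplus\ &(J_1,I_1)^{(l_1-k_2)}\oplus\dots\oplus(J_{t-1},I_{t-1})^{(l_{t-1}-k_t)}\oplus(J_t,I_t)^{(l_t)}\\ \oplus\ &(F_1^T,G_1^T)^{(\underline k_1-\underline l_1)}\oplus\dots\oplus(F_{\underline t-1}^T,G_{\underline t-1}^T)^{(\underline k_{\underline t-1}-\underline l_{\underline t-1})}\oplus(F_{\underline t}^T,G_{\underline t}^T)^{(\underline k_{\underline t}-\underline l_{\underline t})}\\ \oplus\ &(I_1,J_1)^{(\underline l_1-\underline k_2)}\oplus\dots\oplus(I_{\underline t-1},J_{\underline t-1})^{(\underline l_{\underline t-1}-\underline k_{\underline t})}\oplus(I_{\underline t},J_{\underline t})^{(\underline l_{\underline t})}\\ \oplus\ &(\underline B_{\underline t}^{T},\underline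 A_{\underline t}^{T}) \end{aligned}$$ (all exponents in parentheses are nonnegative). The pair $(\underline B_{\underline t}^{T},\underline A_{\underline t}^{T})$ consists of nonsingular matrices; it is determined up to mixed equivalence. The other summands are uniquely determined by $(A,B)$.
   Context: All matrices are complex; $\bar R$ denotes the entrywise complex conjugate of $R$ and $R^T$ its transpose (without conjugation). Pairs $(A,B)$ and $(A',B')$ of $m\times n$ matrices are mixed equivalent if there exist nonsingular $S$ and $R$ with $(SAR,SB\bar R)=(A',B')$. The direct sum of pairs is $(A,B)\oplus(C,D)=(A\oplus C,B\oplus D)$ (block diagonal). Matrices of size $m\times 0$, $0\times n$ and $0\times 0$ are allowed. For an integer $n\ge0$, $(A,B)^{(n)}$ is the direct sum of $n$ copies of $(A,B)$ (the pair of $0\times 0$ matrices if $n=0$). $I_n$ is the identity matrix, and $J_n:=J_n(0)$ is the $n\times n$ singular (nilpotent) Jordan block, with ones on the first subdiagonal and zeros elsewhere. For $n\ge1$, $F_n$ and $G_n$ are the $n\times(n-1)$ matrices $$F_n=\begin{bmatrix} 0_{1,n-1} \\ I_{n-1} \end{bmatrix},\qquad G_n=\begin{bmatrix} I_{n-1} \\ 0_{1,n-1} \end{bmatrix};$$ in particular $F_1$ and $G_1$ are both the $1\times0$ matrix. Mixed-equivalence reduction algorithm. Input: a pair $(A,B)=:(A_0,B_0)$ of matrices of the same size. For $i=1,2,\dots$, as long as the rows of $A_{i-1}$ are linearly dependent, perform step $i$: choose a unitary $S_i$ such that $$S_iA_{i-1}=\begin{bmatrix} 0 \\ A' \end{bmatrix}$$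 with the rows of $A'$ linearly independent; let $k_i$ be the number of rows of the zero block, and partition conformally $S_iB_{i-1}=\begin{bmatrix} B' \\ B'' \end{bmatrix}$, where $B'$ has $k_i$ rows. Then choose a unitary $R_i$ such that $B'R_i=[B_i'\ \ 0]$, where the columns of $B_i'$ are linearly independent; let $l_i$ be the number of columns of $B_i'$. Then $$(S_iA_{i-1}\bar R_i,\ S_iB_{i-1}R_i)=\left(\begin{bmatrix} 0_{k_il_i} & 0 \\ \star & A_i \end{bmatrix},\begin{bmatrix} B_i' & 0 \\ \star & B_i \end{bmatrix}\right),$$ where $0_{k_il_i}$ is the $k_i\times l_i$ zero matrix; this defines the pair $(A_i,B_i)$. The algorithm stops at the first $t$ for which the rows of $A_t$ are linearly independent; the output is $(k_1,l_1),\dots,(k_t,l_t),(A_t,B_t)$. If the rows of $A$ are already linearly independent, then $t=0$, there are no pairs $(k_i,l_i)$, $(A_t,B_t)=(A,B)$, and the corresponding direct sums are empty.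
   Formalization: The second run is applied to (B_t^T, A_t^* ) with the conjugate transpose instead of A_t^T, and the last summand is (\underline B^*, \underline A^T) instead of (\underline B^T, \underline A^T); as printed the claim fails for A = B = [i, -1]. *)

(* Defs.v *)
From HB Require Import structures.
From mathcomp Require Import all_boot all_order all_algebra.
From mathcomp Require Export complex.
From mathcomp Require Export reals.

Set Implicit Arguments.
Unset Strict Implicit.
Unset Printing Implicit Defensive.

Import Order.TTheory GRing.Theory Num.Theory Num.Def.
Local Open Scope ring_scope.
Local Open Scope sesquilinear_scope.

(* A pair of matrices of the same size, with the size bundled, so that direct
   sums of pairs and iterated direct sums need no casts. *)
Record mxpair (C : Type) := MxPair {
  pair_rows : nat;
  pair_cols : nat;
  pair_fst : 'M[C]_(pair_rows, pair_cols);
  pair_snd : 'M[C]_(pair_rows, pair_cols) }.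

Section Pairs.
Variable C : numClosedFieldType.
Implicit Types P Q : mxpair C.

(* map_mx conjC M is the entrywise conjugate, M ^t* the conjugate transpose. *)
Inductive mixed_equiv : mxpair C -> mxpair C -> Prop :=
  MixedEquiv m n (A B : 'M[C]_(m, n)) (S : 'M[C]_m) (R : 'M[C]_n) :
    S \in unitmx -> R \in unitmx ->
    mixed_equiv (MxPair A B)
                (MxPair (S *m A *m R) (S *m B *m map_mx conjC R)).

Definition pair0 : mxpair C := MxPair (0 : 'M[C]_(0, 0)) 0.

Definition dsum P Q : mxpair C :=
  MxPair (block_mx (pair_fst P) 0 0 (pair_fst Q))
         (block_mx (pair_snd P) 0 0 (pair_snd Q)).

Definition copies P (n : nat) : mxpair C := iter n (dsum P) pair0.

Definition nonsingular_pair P : Prop :=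
  exists n (A B : 'M[C]_n),
    [/\ P = MxPair A B, A \in unitmx & B \in unitmx].

Definition F_mx n : 'M[C]_(n, n.-1) := \matrix_(i, j) (i == j.+1 :> nat)%:R.
Definition G_mx n : 'M[C]_(n, n.-1) := \matrix_(i, j) (i == j :> nat)%:R.
Definition J_mx n : 'M[C]_n := \matrix_(i, j) (i == j.+1 :> nat)%:R.

Definition FG n : mxpair C := MxPair (F_mx n) (G_mx n).
Definition JI n : mxpair C := MxPair (J_mx n) 1%:M.
Definition FGt n : mxpair C := MxPair (F_mx n)^T (G_mx n)^T.
Definition IJ n : mxpair C := MxPair 1%:M (J_mx n).

(* One step of the reduction algorithm, for any admissible unitary matrices S
   and R; (k, l) is read off the shapes of the blocks. Since S *m A has its
   first k rows zero with A' of full row rank, ~~ row_free A amounts to k > 0. *)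
Inductive red_step : mxpair C -> nat * nat -> mxpair C -> Prop :=
  RedStep k l m n (A B : 'M[C]_(k + m, l + n)) (S : 'M[C]_(k + m))
      (R : 'M[C]_(l + n)) (A' : 'M[C]_(m, l + n)) (B1 : 'M[C]_(k, l)) :
    ~~ row_free A ->
    S \is unitarymx -> S *m A = col_mx 0 A' -> row_free A' ->
    R \is unitarymx -> usubmx (S *m B) *m R = row_mx B1 0 -> row_free B1^T ->
    red_step (MxPair A B) (k, l)
      (MxPair (drsubmx (S *m A *m map_mx conjC R)) (drsubmx (S *m B *m R))).

(* reduction P s Q: some complete run of the algorithm on P outputs the list
   s = [:: (k_1, l_1); ...; (k_t, l_t)] and the pair Q. *)
Inductive reduction : mxpair C -> seq (nat * nat) -> mxpair C -> Prop :=
| RedStop P : row_free (pair_fst P) -> reduction P [::] P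
| RedCons P kl P1 s Q :
    red_step P kl P1 -> reduction P1 s Q -> reduction P (kl :: s) Q.

(* If (A, B) becomes (S A R, S B conj(R)), then (B^T, A^* ) becomes
   (S' B^T R', S' A^* conj(R')) with S' = R^* and R' = S^T; so this duality
   preserves mixed equivalence. Without the conjugation of the second
   component, (B^T, A^T) would not be preserved. *)
Definition dual_pair P : mxpair C :=
  MxPair (pair_snd P)^T ((pair_fst P) ^t*).

Definition undual_pair P : mxpair C :=
  MxPair ((pair_snd P) ^t*) (pair_fst P)^T.

Lemma dual_pairK : cancel dual_pair undual_pair.
Proof.
case=> m n A B; rewrite /undual_pair /= trmxK; congr MxPair.
by apply/matrixP=> i j; rewrite !mxE conjCK.
Qed.

(* Entry i (from 0) of each list is the multiplicity of the block of index
   i + 1. *)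
Definition decomposition (f j ft jt : seq nat) Q : mxpair C :=
  dsum (\big[dsum/pair0]_(0 <= i < size f) copies (FG i.+1) (nth 0%N f i))
 (dsum (\big[dsum/pair0]_(0 <= i < size j) copies (JI i.+1) (nth 0%N j i))
 (dsum (\big[dsum/pair0]_(0 <= i < size ft) copies (FGt i.+1) (nth 0%N ft i))
 (dsum (\big[dsum/pair0]_(0 <= i < size jt) copies (IJ i.+1) (nth 0%N jt i))
       Q))).

End Pairs.

(* k_i and l_i for 1 <= i <= t, extended by 0 for i > t, so that
   l_t - k_(t+1) = l_t. *)
Definition out_k (s : seq (nat * nat)) (i : nat) : nat :=
  (nth (0%N, 0%N) s i.-1).1.
Definition out_l (s : seq (nat * nat)) (i : nat) : nat :=
  (nth (0%N, 0%N) s i.-1).2.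

Definition F_mults (s : seq (nat * nat)) : seq nat :=
  [seq (out_k s i - out_l s i)%N | i <- iota 1 (size s)].
Definition J_mults (s : seq (nat * nat)) : seq nat :=
  [seq (out_l s i - out_k s i.+1)%N | i <- iota 1 (size s)].

(* The subtractions in F_mults and J_mults are not truncated. *)
Definition mults_nonneg (s : seq (nat * nat)) : Prop :=
  forall i, (1 <= i <= size s)%N ->
    (out_l s i <= out_k s i)%N /\ (out_k s i.+1 <= out_l s i)%N.

Definition same_mults (f g : seq nat) : Prop :=
  forall i, nth 0%N f i = nth 0%N g i.

(* Main.v *)
(* A pair is a linear map together with a conjugate-linear map between the same
   spaces. Up to isomorphism a reduction step writes P as
   ([0 0; X A1], [B1 0; Y B2]) with [X A1] of full row rank and B1 of full column
   rank, and P1 = (A1, B2). Conversely k, l and the class of P1 determine the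
   class of P: the columns of X matter only modulo those of A1, where they span
   the whole cokernel, so any two choices of X are related by an invertible
   column operation, after which Y is cleared by means of B1. Steps add up over
   direct sums, send (F_(i+1), G_(i+1)) to (F_i, G_i) and (J_(i+1), I_(i+1)) to
   (J_i, I_i), and do nothing to a pair whose first matrix has independent rows.
   Existence and uniqueness of the decomposition then follow together by
   induction along a run of the algorithm; duality settles the other half. *)

Require Import Defs.
From HB Require Import structures.
From mathcomp Require Import all_boot all_order all_algebra.
From mathcomp Require Import complex reals zify.

Set Implicit Arguments.
Unset Strict Implicit.
Unset Printing Implicit Defensive.

Import Order.TTheory GRing.Theory Num.Theory Num.Def.
Local Open Scope ring_scope.
Local Open Scope sesquilinear_scope.

(** * Isomorphism of pairs, its compatibility with direct sums and with duality *)

Section PairIsomorphism.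
Variable C : numClosedFieldType.
Implicit Types P Q : mxpair C.

Local Notation "M ^c" := (map_mx conjC M) : ring_scope.

Definition mxsimp := (mulmx0, mul0mx, mulmx1, mul1mx, addr0, add0r).

(* Invertible matrices are allowed to be formally rectangular, so that no cast
   is needed to reassociate or permute direct summands. *)
Definition pair_iso P Q : Prop :=
  exists (S : 'M[C]_(pair_rows Q, pair_rows P)) (S' : 'M[C]_(pair_rows P, pair_rows Q))
         (R : 'M[C]_(pair_cols P, pair_cols Q)) (R' : 'M[C]_(pair_cols Q, pair_cols P)),
    [/\ S *m S' = 1%:M /\ S' *m S = 1%:M,
        R *m R' = 1%:M /\ R' *m R = 1%:M,
        S *m pair_fst P *m R = pair_fst Q
      & S *m pair_snd P *m R^c = pair_snd Q].

(** Two-sided inverses force equal sizes; after identifying these, [S] and [R] are square and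
    invertible. *)
Lemma pair_iso_mixed P Q : pair_iso P Q -> mixed_equiv P Q.
Proof.
case: P Q => [m n A B] [m' n' A' B'] [S [S' [R [R' /= [[SS SS'] [RR RR'] eA eB]]]]].
have em : m' = m by apply/eqP; rewrite eqn_leq (mulmx1_min SS) (mulmx1_min SS').
have en : n' = n by apply/eqP; rewrite eqn_leq (mulmx1_min RR) (mulmx1_min RR').
subst m' n'; rewrite -eA -eB.
by constructor; [case: (mulmx1_unit SS) | case: (mulmx1_unit RR)].
Qed.

Lemma mixed_pair_iso P Q : mixed_equiv P Q -> pair_iso P Q.
Proof.
case=> m n A B S R uS uR; exists S, (invmx S), R, (invmx R).
by split; rewrite //= ?mulmxV ?mulVmx.
Qed.

Lemma conj_mxK m n (M : 'M[C]_(m, n)) : M^c^c = M.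
Proof. by apply/matrixP=> i j; rewrite !mxE conjCK. Qed.

Lemma conj_mx1 n : (1%:M : 'M[C]_n)^c = 1%:M.
Proof. by rewrite map_mx1. Qed.

Lemma pair_iso_refl P : pair_iso P P.
Proof.
by exists 1%:M, 1%:M, 1%:M, 1%:M; rewrite conj_mx1 !mulmx1 !mul1mx.
Qed.

Lemma pair_iso_sym P Q : pair_iso P Q -> pair_iso Q P.
Proof.
case=> S [S' [R [R' [[SS SS'] [RR RR'] eA eB]]]]; exists S', S, R', R; split=> //.
  by rewrite -eA !mulmxA SS' mul1mx -mulmxA RR mulmx1.
by rewrite -eB !mulmxA SS' mul1mx -mulmxA -map_mxM /= RR conj_mx1 mulmx1.
Qed.

Lemma pair_iso_trans Q P T : pair_iso P Q -> pair_iso Q T -> pair_iso P T.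
Proof.
case=> S [S' [R [R' [[SS SS'] [RR RR'] eA eB]]]].
case=> U [U' [V [V' [[UU UU'] [VV VV'] eA2 eB2]]]].
exists (U *m S), (S' *m U'), (R *m V), (V' *m R'); split.
- by rewrite mulmxA -(mulmxA U) SS mulmx1 UU mulmxA -(mulmxA S') UU' mulmx1.
- by rewrite mulmxA -(mulmxA R) VV mulmx1 RR mulmxA -(mulmxA V') RR' mulmx1.
- by rewrite -eA2 -eA !mulmxA.
- by rewrite -eB2 -eB map_mxM !mulmxA.
Qed.

Lemma pair_iso_dsum P P' Q Q' :
  pair_iso P P' -> pair_iso Q Q' -> pair_iso (dsum P Q) (dsum P' Q').
Proof.
case=> S [S' [R [R' [[SS SS'] [RR RR'] eA eB]]]].
case=> U [U' [V [V' [[UU UU'] [VV VV'] eA2 eB2]]]].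
exists (block_mx S 0 0 U), (block_mx S' 0 0 U'), (block_mx R 0 0 V), (block_mx R' 0 0 V').
by rewrite /= map_block_mx !map_mx0 !mulmx_block !mxsimp SS SS' RR RR' UU UU' VV VV'
           eA eB eA2 eB2 -!scalar_mx_block.
Qed.

Lemma pair_iso0l P : pair_iso (dsum (pair0 C) P) P.
Proof.
exists (row_mx 0 1%:M), (col_mx 0 1%:M), (col_mx 0 1%:M), (row_mx 0 1%:M) => /=.
have h (T : nat) : col_mx 0 1%:M *m row_mx 0 1%:M = 1%:M :> 'M[C]_(0 + T).
  by rewrite mul_col_row !mxsimp [RHS]scalar_mx_block [X in _ = block_mx X _ _ _]flatmx0.
rewrite map_col_mx map_mx0 conj_mx1 !mul_row_block !mul_row_col !mxsimp.
by rewrite !h.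
Qed.

Lemma row_free_iso P Q : pair_iso P Q -> row_free (pair_fst P) -> row_free (pair_fst Q).
Proof.
case=> S [S' [R [R' [[SS SS'] [RR RR'] eA eB]]]] /row_freeP[D AD].
apply/row_freeP; exists (R' *m D *m S').
by rewrite -eA !mulmxA -(mulmxA _ R) RR mulmx1 -(mulmxA S) AD mulmx1.
Qed.

Lemma row_free_dsum P Q :
  row_free (pair_fst P) -> row_free (pair_fst Q) -> row_free (pair_fst (dsum P Q)).
Proof. by rewrite /row_free /= rank_diag_block_mx => /eqP-> /eqP->. Qed.

Lemma pair_iso_dual P Q : pair_iso P Q -> pair_iso (dual_pair P) (dual_pair Q).
Proof.
case=> S [S' [R [R' [[SS SS'] [RR RR'] eA eB]]]].
exists (R^c^T), (R'^c^T), (S^T), (S'^T); split=> /=.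
- by rewrite -!trmx_mul -!map_mxM RR RR' !map_mx1 !trmx1. 
- by rewrite -!trmx_mul SS SS' !trmx1.
- by rewrite -eB !trmx_mul mulmxA.
- by rewrite -eA !trmx_mul !map_mxM mulmxA !map_trmx.
Qed.

Lemma pair_iso_undual P Q : pair_iso P Q -> pair_iso (undual_pair P) (undual_pair Q).
Proof.
case=> S [S' [R [R' [[SS SS'] [RR RR'] eA eB]]]].
exists (R^T), (R'^T), (S^c^T), (S'^c^T); split=> /=.
- by rewrite -!trmx_mul RR RR' !trmx1.
- by rewrite -!trmx_mul -!map_mxM SS SS' !map_mx1 !trmx1.
- by rewrite -eB !trmx_mul !map_mxM !mulmxA -!map_trmx conj_mxK.
- by rewrite -eA !trmx_mul mulmxA -!map_trmx conj_mxK.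
Qed.

End PairIsomorphism.

(** * One reduction step up to isomorphism: lifting and determinacy *)

Section AbstractStep.
Variable C : numClosedFieldType.
Implicit Types P Q : mxpair C.

Local Notation "M ^c" := (map_mx conjC M) : ring_scope.

Definition step_ext Q k l (X Y : 'M[C]_(pair_rows Q, l)) (B : 'M[C]_(k, l)) : mxpair C :=
  MxPair (block_mx 0 0 X (pair_fst Q)) (block_mx B 0 Y (pair_snd Q)).

(* A reduction step up to isomorphism; the trivial step k = l = 0 is allowed,
   which makes steps additive under direct sums. *)
Definition iso_step P k l Q : Prop :=
  exists (X Y : 'M[C]_(pair_rows Q, l)) (B : 'M[C]_(k, l)),
    [/\ pair_iso P (step_ext X Y B), row_free (row_mx X (pair_fst Q))
      & row_free B^T].

Lemma iso_step_isor P k l Q Q' : pair_iso Q Q' -> iso_step P k l Q -> iso_step P k l Q'.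
Proof.
case=> S [S' [R [R' [[SS SS'] [RR RR'] eA eB]]]].
case=> X [Y [B [PX X_free B_free]]]; exists (S *m X), (S *m Y), B; split=> //.
  apply: pair_iso_trans PX _.
  exists (block_mx 1%:M 0 0 S), (block_mx 1%:M 0 0 S').
  exists (block_mx 1%:M 0 0 R), (block_mx 1%:M 0 0 R').
  rewrite /= map_block_mx !map_mx0 conj_mx1 !mulmx_block !mxsimp.
  by rewrite SS SS' RR RR' eA eB -!scalar_mx_block.
case/row_freeP: X_free => D; rewrite -[D]vsubmxK mul_row_col => XD.
apply/row_freeP; exists (col_mx (usubmx D *m S') (R' *m dsubmx D *m S')).
rewrite mul_row_col -eA !mulmxA -(mulmxA _ R) RR mulmx1 -mulmxDl.
by rewrite -!(mulmxA S) -mulmxDr XD mulmx1 SS.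
Qed.

(** A left inverse [D^T] of [B] allows [Y *m D^T] times the top rows to be subtracted from the
    bottom ones. The first matrix is unaffected, as its top rows vanish. *)
Lemma step_ext_clear Q k l (X Y : 'M[C]_(pair_rows Q, l)) (B : 'M[C]_(k, l)) :
  row_free B^T -> pair_iso (step_ext X Y B) (step_ext X 0 B).
Proof.
case/row_freeP=> D BD; have {BD} DB : D^T *m B = 1%:M.
  by apply: trmx_inj; rewrite trmx_mul trmxK BD trmx1.
exists (block_mx 1%:M 0 (- (Y *m D^T)) 1%:M), (block_mx 1%:M 0 (Y *m D^T) 1%:M).
exists 1%:M, 1%:M; rewrite /= conj_mx1 !mulmx1 !mulmx_block !mxsimp.
rewrite mulNmx -mulmxA DB mulmx1 !addNr !subrr.
by rewrite -!scalar_mx_block.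
Qed.

(** The column operation with blocks [U 0; Z 1] adds combinations of the columns of [pair_fst Q] to
    [X]; its conjugate acts on the second matrix, whose zero top right block keeps [Z] away from
    [B]. *)
Lemma step_ext_change Q k l (X X' Y : 'M[C]_(pair_rows Q, l)) (Z : 'M[C]_(pair_cols Q, l))
    (B B' : 'M[C]_(k, l)) (U : 'M[C]_l) (V : 'M[C]_k) :
  U \in unitmx -> V \in unitmx ->
  X' = X *m U + pair_fst Q *m Z -> B' = V *m B *m U^c ->
  pair_iso (step_ext X Y B) (step_ext X' (Y *m U^c + pair_snd Q *m Z^c) B').
Proof.
move=> uU uV -> ->.
exists (block_mx V 0 0 1%:M), (block_mx (invmx V) 0 0 1%:M).
exists (block_mx U 0 Z 1%:M), (block_mx (invmx U) 0 (- (Z *m invmx U)) 1%:M).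
rewrite /= map_block_mx !map_mx0 conj_mx1 !mulmx_block !mxsimp.
rewrite !mulNmx -?mulmxA !mulVmx // !mulmxV // ?mulmx1 ?subrr ?addrN ?addNr.
by rewrite -!scalar_mx_block.
Qed.

(** Work modulo the row space of [A], that is, after multiplication by [cokermx A]. There [X] and
    [X'] both span everything, so an invertible [U] relates them; the error [X' - U *m X] lies in
    the row space of [A]. *)
Lemma row_full_change m n p (X X' : 'M[C]_(m, n)) (A : 'M[C]_(p, n)) :
    row_full (col_mx X A) -> row_full (col_mx X' A) ->
  exists2 U, U \in unitmx & exists Z, X' = U *m X + Z *m A.
Proof.
move=> fX fX'; pose q := cokermx A.
have Aq : A *m q = 0 by exact: mulmx_coker.
have fullq (T : 'M[C]_(m, n)) : row_full (col_mx T A) -> (T *m q :=: q)%MS.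
  move=> fT; apply: (eqmx_trans _ (eqmxMfull q fT)).
  rewrite mul_col_mx Aq; apply/eqmxP/andP; split; first by rewrite -addsmxE addsmxSl.
  by rewrite -addsmxE addsmx_sub submx_refl sub0mx.
have /eqmxMunitP[U uU eU] : (X' *m q == X *m q)%MS.
  by apply/eqmxP/(eqmx_trans (fullq _ fX'))/eqmx_sym/fullq.
exists U => //; have /submxP[Z eZ] : (X' - U *m X <= A)%MS.
  by rewrite submxE mulmxBl eU mulmxA subrr.
by exists Z; rewrite -eZ addrC subrK.
Qed.

Lemma row_full_unit_change m n (B B' : 'M[C]_(m, n)) :
  row_full B -> row_full B' -> exists2 V, V \in unitmx & B' = V *m B.
Proof.
move=> fB fB'; have /eqmxMunitP[V uV eV] : (B' == B)%MS; last by exists V.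
by rewrite !submx_full.
Qed.

Lemma iso_step_lift P P' k l Q Q' :
  iso_step P k l Q -> iso_step P' k l Q' -> pair_iso Q Q' -> pair_iso P P'.
Proof.
move=> PQ P'Q' QQ'; have := iso_step_isor QQ' PQ.
case: P'Q' => X' [Y' [B' [P'X X'_free B'_free]]].
case=> X [Y [B [PX X_free B_free]]].
apply: pair_iso_trans PX _; apply: pair_iso_trans (pair_iso_sym P'X).
have tr_full T : row_free (row_mx T (pair_fst Q')) -> row_full (col_mx T^T (pair_fst Q')^T).
  by rewrite -tr_row_mx /row_full mxrank_tr.
(* Transposes are taken because [X] is to be changed by column operations. *)
have [U uU [Z eX']] := row_full_change (tr_full _ X X_free) (tr_full _ X' X'_free).
have {}eX' : X' = X *m U^T + pair_fst Q' *m Z^T.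
  by apply: trmx_inj; rewrite linearD /= !trmx_mul !trmxK.
have uUT : U^T \in unitmx by rewrite unitmx_tr.
have tr_full_B (T : 'M[C]_(k, l)) : row_free T^T -> row_full T.
  by rewrite /row_free /row_full mxrank_tr.
have fBU : row_full (B *m U^T^c).
  rewrite /row_full mxrankMfree; first exact: tr_full_B.
  by rewrite row_free_unit map_unitmx.
(* [V] is chosen after [U]: it must correct the effect of the conjugate of [U] on [B]. *)
have [V uV eB'] := row_full_unit_change fBU (tr_full_B _ B'_free).
(* The change by [Z] refills the lower left block of the second matrix, so a second clearing
   follows, and a third one for [Y']. *)
apply: pair_iso_trans (step_ext_clear X Y B_free) _.
rewrite mulmxA in eB'; apply: pair_iso_trans (step_ext_change 0 uUT uV eX' eB') _.
apply: pair_iso_trans (step_ext_clear _ _ _) _ => //.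
by apply/pair_iso_sym/step_ext_clear.
Qed.

(** The top rows of the product give [ursubmx S *m row_mx X A *m R = 0], and both factors on the
    right can be cancelled. *)
Lemma ursubmx_fst_eq0 k m l n k' m' l' n' (X : 'M[C]_(m, l)) (A : 'M_(m, n))
    (X' : 'M_(m', l')) (A' : 'M_(m', n')) (D : 'M_(l + n, m))
    (S : 'M_(k' + m', k + m)) (R : 'M_(l + n, l' + n')) R' :
  row_mx X A *m D = 1%:M -> R *m R' = 1%:M ->
  S *m block_mx (0 : 'M_(k, l)) 0 X A *m R = block_mx 0 0 X' A' -> ursubmx S = 0.
Proof.
move=> XD RR /(congr1 (fun M => usubmx (M *m (R' *m D)))).
rewrite mulmxA -(mulmxA _ R) RR mulmx1 -{1}[S]submxK mulmx_block !mxsimp !block_mxEv.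
by rewrite row_mx0 !mul_col_mx !col_mxKu mul0mx -mul_mx_row -mulmxA XD mulmx1.
Qed.

(** With [S] block lower triangular, the top right block of the product is
    [ulsubmx S *m B *m ursubmx R]; the left inverses [S1] and [E] cancel the first two factors. *)
Lemma ursubmx_snd_eq0 k m l n k' m' l' n' (Y : 'M[C]_(m, l)) (A : 'M_(m, n)) (B : 'M_(k, l))
    (Y' : 'M_(m', l')) (A' : 'M_(m', n')) (B' : 'M_(k', l')) (E : 'M_(l, k))
    (S : 'M_(k' + m', k + m)) (R : 'M_(l + n, l' + n')) S1 :
  E *m B = 1%:M -> S1 *m ulsubmx S = 1%:M -> ursubmx S = 0 ->
  S *m block_mx B 0 Y A *m R = block_mx B' 0 Y' A' -> ursubmx R = 0.
Proof.
move=> EB SS S0 /(congr1 (fun M => E *m (S1 *m ursubmx M))).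
rewrite -[S]submxK S0 -[R]submxK !mulmx_block !block_mxKur !mxsimp.
by rewrite !mulmxA -(mulmxA E) SS mulmx1 EB mul1mx.
Qed.

Lemma mul_ltrig_eq1 k m k' m' (S : 'M[C]_(k' + m', k + m)) (S' : 'M_(k + m, k' + m')) :
  ursubmx S = 0 -> ursubmx S' = 0 -> S *m S' = 1%:M ->
  ulsubmx S *m ulsubmx S' = 1%:M /\ drsubmx S *m drsubmx S' = 1%:M.
Proof.
move=> S0 S0'; rewrite -{1}[S]submxK -{1}[S']submxK S0 S0' mulmx_block !mxsimp.
by rewrite scalar_mx_block => /eq_block_mx[].
Qed.

(** An isomorphism between the extensions, and likewise its inverse, is block lower triangular:
    first on rows by the first matrix, then on columns by the second. The upper diagonal blocks are
    then invertible and give the equalities of sizes; the lower ones give the isomorphism of [Q] and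
    [Q']. *)
Lemma iso_step_det P P' k l k' l' Q Q' :
  iso_step P k l Q -> iso_step P' k' l' Q' -> pair_iso P P' ->
  [/\ k = k', l = l' & pair_iso Q Q'].
Proof.
case=> X [Y [B [PX /row_freeP[D XD] /row_freeP[E BE]]]].
case=> X' [Y' [B' [P'X' /row_freeP[D' XD'] /row_freeP[E' BE']]]] PP'.
have {BE}EB : E^T *m B = 1%:M.
  by apply: trmx_inj; rewrite trmx_mul trmxK BE trmx1.
have {BE'}EB' : E'^T *m B' = 1%:M.
  by apply: trmx_inj; rewrite trmx_mul trmxK BE' trmx1.
have : pair_iso (step_ext X Y B) (step_ext X' Y' B').
  by apply: pair_iso_trans P'X'; apply: pair_iso_trans PP'; apply: pair_iso_sym.
case=> S [S' [R [R' [/= [SS SS'] [RR RR'] eA eB]]]].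
have cRR : R^c *m R'^c = 1%:M by rewrite -map_mxM RR map_mx1.
have eA' : S' *m block_mx 0 0 X' (pair_fst Q') *m R' = block_mx 0 0 X (pair_fst Q).
  by rewrite -eA !mulmxA SS' mul1mx -mulmxA RR mulmx1.
have eB' : S' *m block_mx B' 0 Y' (pair_snd Q') *m R'^c = block_mx B 0 Y (pair_snd Q).
  by rewrite -eB !mulmxA SS' mul1mx -mulmxA cRR mulmx1.
have S0 := ursubmx_fst_eq0 XD RR eA; have S0' := ursubmx_fst_eq0 XD' RR' eA'.
have [SSul SSdr] := mul_ltrig_eq1 S0 S0' SS.
have [SSul' SSdr'] := mul_ltrig_eq1 S0' S0 SS'.
have conj0 p q p' q' (M : 'M[C]_(p + q, p' + q')) : ursubmx M^c = 0 -> ursubmx M = 0.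
  by rewrite -map_ursubmx => /(congr1 (fun N => N^c)); rewrite conj_mxK map_mx0.
have R0 := conj0 _ _ _ _ _ (ursubmx_snd_eq0 EB SSul' S0 eB).
have R0' := conj0 _ _ _ _ _ (ursubmx_snd_eq0 EB' SSul S0' eB').
have [RRul RRdr] := mul_ltrig_eq1 R0 R0' RR.
have [RRul' RRdr'] := mul_ltrig_eq1 R0' R0 RR'.
split; try by apply/eqP; rewrite eqn_leq;
  rewrite ?(mulmx1_min SSul) ?(mulmx1_min SSul') ?(mulmx1_min RRul) ?(mulmx1_min RRul').
exists (drsubmx S), (drsubmx S'), (drsubmx R), (drsubmx R'); split=> //.
  move: eA => /(congr1 drsubmx); rewrite -{1}[S]submxK -{1}[R]submxK S0 R0.
  by rewrite !mulmx_block !block_mxKdr !mxsimp.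
move: eB => /(congr1 drsubmx); rewrite -{1}[S]submxK -{1}[R]submxK S0 R0 map_block_mx.
by rewrite map_mx0 !mulmx_block !block_mxKdr !mxsimp.
Qed.
End AbstractStep.

(** * Steps on direct sums and on the canonical blocks *)

Section Summands.
Variable C : numClosedFieldType.
Implicit Types P Q : mxpair C.

Local Notation "M ^c" := (map_mx conjC M) : ring_scope.

Lemma iso_step_refl P : row_free (pair_fst P) -> iso_step P 0 0 P.
Proof.
move=> P_free; exists 0, 0, 0; split; last by rewrite /row_free flatmx0 mxrank0.
- by apply: pair_iso_sym; apply: pair_iso_trans (pair_iso0l P); apply: pair_iso_refl.
- by rewrite /row_free rank_row_0mx.
Qed.

(** The permutation matrix exchanging the two middle ones of four blocks, formally rectangular to
    avoid a cast. *)
Definition swap_mx k m k' m' : 'M[C]_((k + k') + (m + m'), (k + m) + (k' + m')) :=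
  block_mx (block_mx 1%:M 0 0 0) (block_mx 0 0 1%:M 0)
           (block_mx 0 1%:M 0 0) (block_mx 0 0 0 1%:M).

Lemma swap_mxK k m k' m' :
  swap_mx k m k' m' *m swap_mx k k' m m' = 1%:M.
Proof.
rewrite /swap_mx !mulmx_block !mxsimp !add_block_mx !mxsimp.
by rewrite !block_mx0 -!scalar_mx_block.
Qed.

Lemma conj_swap_mx k m k' m' : (swap_mx k m k' m')^c = swap_mx k m k' m'.
Proof. by rewrite /swap_mx !map_block_mx !map_mx0 !map_mx1. Qed.

(** Moving the split-off rows and columns of both summands to the front turns a sum of extensions
    into an extension of the sum. *)
Lemma iso_step_dsum P Q k l P' Q' k' l' :
  iso_step P k l Q -> iso_step P' k' l' Q' ->
  iso_step (dsum P P') (k + k') (l + l') (dsum Q Q').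
Proof.
case=> X [Y [B [PX X_free B_free]]] [X' [Y' [B' [P'X' X'_free B'_free]]]].
exists (block_mx X 0 0 X'), (block_mx Y 0 0 Y'), (block_mx B 0 0 B'); split.
- apply: pair_iso_trans (pair_iso_dsum PX P'X') _.
  exists (swap_mx _ _ _ _), (swap_mx _ _ _ _), (swap_mx _ _ _ _), (swap_mx _ _ _ _).
  split; rewrite ?swap_mxK ?conj_swap_mx //= /swap_mx !mulmx_block !mxsimp !mulmx_block
    !mxsimp !add_block_mx !mxsimp ?block_mx0 //.

- move: X_free X'_free => /row_freeP[D XD] /row_freeP[D' XD'].
  rewrite -[D]vsubmxK -[D']vsubmxK !mul_row_col in XD XD'.
  rewrite /=; apply/row_freeP; exists (col_mx (block_mx (usubmx D) 0 0 (usubmx D'))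
                                  (block_mx (dsubmx D) 0 0 (dsubmx D'))).
  by rewrite mul_row_col !mulmx_block !mxsimp add_block_mx !mxsimp XD XD' -scalar_mx_block.
- by rewrite tr_block_mx !trmx0 /row_free rank_diag_block_mx (eqP B_free) (eqP B'_free).
Qed.

Lemma iso_step_copies P Q k l n :
  iso_step P k l Q -> iso_step (copies P n) (n * k) (n * l) (copies Q n).
Proof.
move=> PQ; elim: n => [|n IHn]; last exact: iso_step_dsum.
by apply: iso_step_refl; rewrite /row_free mxrank0.
Qed.

Lemma pair_iso_copies P Q n : pair_iso P Q -> pair_iso (copies P n) (copies Q n).
Proof.
by move=> PQ; elim: n => [|n IHn]; [apply: pair_iso_refl | apply: pair_iso_dsum].
Qed.

Lemma pair_iso_copies0 n : pair_iso (copies (pair0 C) n) (pair0 C).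
Proof.
elim: n => [|n IHn]; first exact: pair_iso_refl.
exact: pair_iso_trans (pair_iso0l _) IHn.
Qed.

(** The family [E] is a parameter, so that passing to the tail of [f] only shifts [E]. The four big
    sums in [decomposition] are instances by conversion. *)
Definition dsum_mults (E : nat -> mxpair C) (f : seq nat) : mxpair C :=
  \big[@dsum C/pair0 C]_(0 <= i < size f) copies (E i) (nth 0%N f i).

Lemma dsum_mults_nil E : dsum_mults E [::] = pair0 C.
Proof. by rewrite /dsum_mults big_geq. Qed.

Lemma dsum_mults_cons E x f :
  dsum_mults E (x :: f) = dsum (copies (E 0) x) (dsum_mults (fun i => E i.+1) f).
Proof. by rewrite /dsum_mults big_nat_recl. Qed.

Lemma iso_step_mults (E E' : nat -> mxpair C) (a b : nat -> nat) f :
  (forall i, iso_step (E i) (a i) (b i) (E' i)) ->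
  iso_step (dsum_mults E f) (\sum_(0 <= i < size f) nth 0%N f i * a i)
    (\sum_(0 <= i < size f) nth 0%N f i * b i) (dsum_mults E' f).
Proof.
elim: f E E' a b => [|x f IHf] E E' a b EE'.
  rewrite !dsum_mults_nil !big_geq //.
  by apply: iso_step_refl; rewrite /row_free mxrank0.
rewrite !dsum_mults_cons /= !big_nat_recl //=.
by apply: iso_step_dsum; [apply: iso_step_copies | apply: IHf => i; apply: EE'].
Qed.

Lemma pair_iso_mults (E E' : nat -> mxpair C) f :
  (forall i, pair_iso (E i) (E' i)) -> pair_iso (dsum_mults E f) (dsum_mults E' f).
Proof.
elim: f E E' => [|x f IHf] E E' EE'; first by rewrite !dsum_mults_nil; apply: pair_iso_refl.
rewrite !dsum_mults_cons; apply: pair_iso_dsum; first exact: pair_iso_copies.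
by apply: IHf => i; apply: EE'.
Qed.

Lemma dsum_mults_eq0 E f : sumn f = 0%N -> pair_iso (dsum_mults E f) (pair0 C).
Proof.
elim: f E => [|x f IHf] E /=; first by rewrite dsum_mults_nil => _; apply: pair_iso_refl.
move=> /eqP; rewrite addn_eq0 dsum_mults_cons => /andP[/eqP-> /eqP f0] /=.
exact: pair_iso_trans (pair_iso0l _) (IHf _ f0).
Qed.

(** After a step each block index has dropped by one and the first block has become empty;
    discarding it restores the indexing from 1, with [behead f] as multiplicities. *)
Lemma dsum_mults_head0 (E : nat -> mxpair C) f : E 0%N = pair0 C ->
  pair_iso (dsum_mults E f) (dsum_mults (fun i => E i.+1) (behead f)).
Proof.
case: f => [|x f] E0 /=; first by rewrite !dsum_mults_nil; apply: pair_iso_refl.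
rewrite dsum_mults_cons E0; apply: pair_iso_trans (pair_iso0l _).
by apply: pair_iso_dsum; [apply: pair_iso_copies0 | apply: pair_iso_refl].
Qed.

Lemma row_free_mults (E : nat -> mxpair C) f :
  (forall i, row_free (pair_fst (E i))) -> row_free (pair_fst (dsum_mults E f)).
Proof.
elim: f E => [|x f IHf] E freeE; first by rewrite dsum_mults_nil /row_free mxrank0.
rewrite dsum_mults_cons; apply: row_free_dsum; last by apply: IHf => i; apply: freeE.
elim: x => [|x IHx]; first by rewrite /row_free mxrank0.
exact: row_free_dsum.
Qed.

Lemma dual_pair_dsum P Q : dual_pair (dsum P Q) = dsum (dual_pair P) (dual_pair Q).
Proof. by rewrite /dual_pair /dsum /= !tr_block_mx map_block_mx !trmx0 !map_mx0. Qed.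

Lemma dual_pair0 : dual_pair (pair0 C) = pair0 C.
Proof. by rewrite /dual_pair /= trmx0 map_mx0. Qed.

Lemma dual_pair_mults E f : dual_pair (dsum_mults E f) = dsum_mults (fun i => dual_pair (E i)) f.
Proof.
elim: f E => [|x f IHf] E; first by rewrite !dsum_mults_nil dual_pair0.
rewrite !dsum_mults_cons dual_pair_dsum IHf; congr dsum.
by elim: x => [|x IHx] /=; rewrite ?dual_pair0 // dual_pair_dsum IHx.
Qed.

(** * Recursive block forms of F, G and J *)

Lemma pair0E (A B : 'M[C]_(0, 0)) : MxPair A B = pair0 C.
Proof. by rewrite [A]flatmx0 [B]flatmx0. Qed.

Lemma FG0 : FG C 0 = pair0 C. Proof. exact: pair0E. Qed.
Lemma JI0 : JI C 0 = pair0 C. Proof. exact: pair0E. Qed.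

Lemma F_mx_block i :
  F_mx C i.+2 = block_mx 0 0 (\col_j (j == 0 :> nat)%:R) (F_mx C i.+1) :> 'M_(1 + i.+1, 1 + i).
Proof.
apply: etrans (esym (@submxK _ 1 i.+1 1 i (F_mx C i.+2))) _.
by congr block_mx; apply/matrixP=> a b; rewrite !mxE /= ?ord1.
Qed.

Lemma G_mx_block i :
  G_mx C i.+2 = block_mx 1%:M 0 0 (G_mx C i.+1) :> 'M_(1 + i.+1, 1 + i).
Proof.
apply: etrans (esym (@submxK _ 1 i.+1 1 i (G_mx C i.+2))) _.
by congr block_mx; apply/matrixP=> a b; rewrite !mxE /= ?ord1.
Qed.

Lemma J_mx_block i :
  J_mx C i.+1 = block_mx 0 0 (\col_j (j == 0 :> nat)%:R) (J_mx C i) :> 'M_(1 + i, 1 + i).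
Proof.
apply: etrans (esym (@submxK _ 1 i 1 i (J_mx C i.+1))) _.
by congr block_mx; apply/matrixP=> a b; rewrite !mxE /= ?ord1.
Qed.

(** The first row of F is zero, and the remaining rows form an identity matrix. The boolean [0 < i]
    counts the columns removed: (F_1, G_1) has none, every larger block loses one. *)
Lemma iso_step_FG i : iso_step (FG C i.+1) 1 (0 < i) (FG C i).
Proof.
case: i => [|i].
  exists 0, 0, 0; split; last by rewrite /row_free flatmx0 mxrank0.
    rewrite (_ : FG C 1 = step_ext (Q := FG C 0) (k := 1) (l := 0) 0 0 0).
      exact: pair_iso_refl.
    congr MxPair; exact: etrans (thinmx0 _) (esym (thinmx0 _)).
  by rewrite /row_free mxrank_eq0 //; apply/eqP/matrixP=> -[].
exists (\col_j (j == 0 :> nat)%:R), 0, 1%:M; split.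
- rewrite /FG F_mx_block G_mx_block; exact: pair_iso_refl.
- have e : row_mx (\col_j (j == 0 :> nat)%:R) (F_mx C i.+1) = 1%:M :> 'M_(i.+1, 1 + i).
    apply: etrans (@hsubmxK _ i.+1 1 i 1%:M).
    by congr row_mx; apply/matrixP=> a b; rewrite !mxE /= ?ord1.
  by have := unitmx1 C i.+1; rewrite -row_free_unit -e.
- by rewrite trmx1 row_free_unit unitmx1.
Qed.

(** Below its zero first row the Jordan block is [I 0], which has full row rank. *)
Lemma iso_step_JI i : iso_step (JI C i.+1) 1 1 (JI C i).
Proof.
exists (\col_j (j == 0 :> nat)%:R), 0, 1%:M; split.
- rewrite (_ : JI C i.+1 = step_ext (Q := JI C i) (\col_j (j == 0 :> nat)%:R) 0 1%:M).
    exact: pair_iso_refl.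
  by congr MxPair; [apply: J_mx_block | exact: (@scalar_mx_block C 1 i 1)].
- have e : row_mx (\col_j (j == 0 :> nat)%:R) (J_mx C i) = pid_mx i :> 'M_(i, 1 + i).
    apply: etrans (@hsubmxK _ i 1 i (pid_mx i)).
    by congr row_mx; apply/matrixP=> a b; rewrite !mxE /= ?ord1 ltn_ord andbT.
  by rewrite /row_free /= e rank_pid_mx // leqnSn.
- by rewrite trmx1 row_free_unit unitmx1.
Qed.

Lemma row_free_FGt i : row_free (pair_fst (FGt C i)).
Proof.
case: i => [|i]; first by rewrite /row_free flatmx0 mxrank0.
have eF : F_mx C i.+1 = col_mx 0 1%:M :> 'M_(1 + i, i).
  apply: etrans (esym (@vsubmxK _ 1 i i (F_mx C i.+1))) _.
  by congr col_mx; apply/matrixP=> a b; rewrite !mxE /= ?ord1.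
have : row_free (col_mx (0 : 'M[C]_(1, i)) 1%:M)^T.
  by rewrite tr_col_mx trmx0 trmx1 /row_free rank_row_0mx mxrank1.
by rewrite -eF.
Qed.

(** Reversing rows and columns exchanges F with G and J with its transpose. This identifies the
    duals (G, F) and (J^T, I) of the transposed blocks with (F, G) and (J, I). *)
Definition rev_mx n : 'M[C]_n := \matrix_(i, j) (i == rev_ord j)%:R.

Lemma rev_mxK n : rev_mx n *m rev_mx n = 1%:M.
Proof.
apply/matrixP=> i j; rewrite !mxE (bigD1 (rev_ord j)) //= !mxE eqxx mulr1 rev_ordK.
rewrite big1 ?addr0 // => k kj; rewrite !mxE; case: eqP kj => [-> /eqP//|]; by rewrite mulr0.
Qed.

Lemma rev_mxE m n (A : 'M[C]_(m, n)) :
  rev_mx m *m A *m rev_mx n = \matrix_(i, j) A (rev_ord i) (rev_ord j).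
Proof.
apply/matrixP=> i j; rewrite !mxE (bigD1 (rev_ord j)) //= !mxE eqxx mulr1.
rewrite (bigD1 (rev_ord i)) //= !mxE rev_ordK eqxx mul1r !big1 ?addr0 // => k ki; rewrite !mxE.
  by rewrite (negPf ki) mulr0.
by rewrite (eq_sym i) (can2_eq (@rev_ordK _) (@rev_ordK _)) (negPf ki) mul0r.
Qed.

Lemma conj_rev_mx n : (rev_mx n)^c = rev_mx n.
Proof. by apply/matrixP=> i j; rewrite !mxE conjC_nat. Qed.

Lemma pair_iso_rev P Q (em : pair_rows P = pair_rows Q) (en : pair_cols P = pair_cols Q) :
  (forall i j, pair_fst Q i j =
    pair_fst P (cast_ord (esym em) (rev_ord i)) (cast_ord (esym en) (rev_ord j))) ->
  (forall i j, pair_snd Q i j =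
    pair_snd P (cast_ord (esym em) (rev_ord i)) (cast_ord (esym en) (rev_ord j))) ->
  pair_iso P Q.
Proof.
case: P Q em en => [m n A B] [m' n' A' B'] /= em en; subst m' n' => eA eB.
exists (rev_mx m), (rev_mx m), (rev_mx n), (rev_mx n).
by split; rewrite /= ?rev_mxK ?conj_rev_mx // rev_mxE; apply/matrixP=> i j;
  rewrite !mxE ?eA ?eB !cast_ord_id.
Qed.

Lemma pair_iso_dual_FGt i : pair_iso (dual_pair (FGt C i)) (FG C i).
Proof.
apply: (@pair_iso_rev (dual_pair (FGt C i)) (FG C i) erefl erefl) => /= a b;
  rewrite !mxE /= ?conjC_nat; congr (nat_of_bool _)%:R;
  by have := ltn_ord a; have := ltn_ord b; lia.
Qed.

Lemma pair_iso_dual_IJ i : pair_iso (dual_pair (IJ C i)) (JI C i).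
Proof.
apply: (@pair_iso_rev (dual_pair (IJ C i)) (JI C i) erefl erefl) => /= a b;
  rewrite !mxE -?val_eqE /= ?conjC_nat; congr (nat_of_bool _)%:R;
  by have := ltn_ord a; have := ltn_ord b; lia.
Qed.
End Summands.

(** * Runs of the algorithm: existence, invariants and uniqueness of multiplicities *)

Section Reductions.
Variable C : numClosedFieldType.
Implicit Types P Q Z : mxpair C.

Local Notation "M ^c" := (map_mx conjC M) : ring_scope.

(** [S1] is an orthonormal basis of the left kernel of [A] and [S2] one of its orthogonal
    complement; counting ranks shows that [S2 *m A] has independent rows. *)
Lemma unitarymx_split m n (A : 'M[C]_(m, n)) :
  exists k p (S1 : 'M[C]_(k, m)) (S2 : 'M[C]_(p, m)),
    [/\ (k + p)%N = m, col_mx S1 S2 \is unitarymx, S1 *m A = 0 & row_free (S2 *m A)].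
Proof.
pose V := kermx A; have := schmidt_complete_unitarymx V.
have kp := add_rank_ortho V.
have := eqmx_schmidt_free (row_base_free V).
rewrite /schmidt_complete; set S1 := schmidt (row_base V); set S2 := schmidt _.
move: kp S2; set p := (X in (_ + X)%N = _) => kp S2 eS1 unitS.
have S1A : S1 *m A = 0 by apply/sub_kermxP; rewrite eS1 eq_row_base.
exists (\rank V), p, S1, S2; split=> //.
have fullS : row_full (col_mx S1 S2) by rewrite /row_full mxrank_unitary // kp.
have := eqmxMfull A fullS; rewrite mul_col_mx S1A => eA.
by rewrite /row_free -(rank_col_0mx (\rank V)) eA -(eqn_add2l (\rank V)) kp
           mxrank_ker subnK ?rank_leq_row.
Qed.

Lemma unitarymx_colC m n p (S : 'M[C]_(m, p)) (T : 'M[C]_(n, p)) :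
  col_mx S T \is unitarymx -> col_mx T S \is unitarymx.
Proof.
move=> /unitarymxP; rewrite tr_col_mx map_row_mx mul_col_row scalar_mx_block.
move=> /eq_block_mx[SS ST TS TT]; apply/unitarymxP.
by rewrite tr_col_mx map_row_mx mul_col_row SS ST TS TT -scalar_mx_block.
Qed.

Lemma red_step_exists P : ~~ row_free (pair_fst P) ->
  exists kl P1, red_step P kl P1 /\ (pair_rows P1 < pair_rows P)%N.
Proof.
case: P => m0 n0 A B /= A_dep.
have [k [m [S1 [S2 [em unitS S1A S2A]]]]] := unitarymx_split A; subst m0.
(* Splitting the transpose gives the column operation; [T1] and [T2] are then swapped, since the
   algorithm puts the zero columns last. *)
have [n [l [T1 [T2 [en unitT T1B T2B]]]]] := unitarymx_split (S1 *m B)^T.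
rewrite addnC in en; subst n0.
pose S := col_mx S1 S2 : 'M_(k + m); pose R := (col_mx T2 T1)^T : 'M_(l + n).
have eSA : S *m A = col_mx 0 (S2 *m A) by rewrite mul_col_mx S1A.
have unitR : R \is unitarymx by rewrite trmx_unitary; apply: unitarymx_colC.
exists (k, l), (MxPair (drsubmx (S *m A *m R^c)) (drsubmx (S *m B *m R))); split.
  apply: (@RedStep _ k l m n A B S R (S2 *m A) (T2 *m (S1 *m B)^T)^T) => //; last by rewrite trmxK.
  rewrite mul_col_mx col_mxKu; apply: trmx_inj; rewrite trmx_mul trmxK mul_col_mx T1B.
  by rewrite tr_row_mx trmxK trmx0.
(* If [k] were 0, the rank of [S2 *m A] would already make the rows of [A] independent. *)
rewrite /= -[ltnLHS]add0n ltn_add2r lt0n; apply: contra A_dep => /eqP k0.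
have := mxrankM_maxr S2 A; rewrite (eqP S2A) => rA.
by rewrite /row_free eqn_leq rank_leq_row {1}k0.
Qed.

Lemma reduction_exists P : exists s Q, reduction P s Q.
Proof.
have [N] := ubnP (pair_rows P); elim: N P => // N IHN P ltPN.
have [P_free|P_dep] := boolP (row_free (pair_fst P)); first by exists [::], P; apply: RedStop.
have [kl [P1 [PP1 ltP1]]] := red_step_exists P_dep.
have [s [Q P1Q]] := IHN P1 (leq_trans ltP1 ltPN).
by exists (kl :: s), Q; apply: RedCons P1Q.
Qed.

Lemma red_step_iso P kl P1 : red_step P kl P1 ->
  ~~ row_free (pair_fst P) /\ iso_step P kl.1 kl.2 P1.
Proof.
case=> k l m n A B S R A' B1 A_dep unitS SA A'_free unitR SB B1_free; split=> //=.
have uS := unitarymx_unit unitS; have uR := unitarymx_unit unitR.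
have uRc : R^c \in unitmx by rewrite map_unitmx.
have eA : S *m A *m R^c = block_mx 0 0 (dlsubmx (S *m A *m R^c)) (drsubmx (S *m A *m R^c)).
  rewrite -{1}[S *m A *m R^c]submxK; congr block_mx; rewrite SA mul_col_mx mul0mx.
    by rewrite /ulsubmx col_mxKu linear0.
  by rewrite /ursubmx col_mxKu linear0.
have eB : S *m B *m R = block_mx B1 0 (dlsubmx (S *m B *m R)) (drsubmx (S *m B *m R)).
  have SBR : usubmx (S *m B *m R) = row_mx B1 0.
    by rewrite -SB -{1}[S *m B]vsubmxK mul_col_mx col_mxKu.
  by rewrite -{1}[S *m B *m R]submxK /ulsubmx /ursubmx SBR row_mxKl row_mxKr.
exists (dlsubmx (S *m A *m R^c)), (dlsubmx (S *m B *m R)), B1; split=> //.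
  (* The algorithm conjugates [R] on the first matrix, [pair_iso] on the second; hence the witness
     [R^c]. *)
  exists S, (invmx S), R^c, (invmx R^c); rewrite /= conj_mxK -eA -eB.
  by rewrite !mulmxV // !mulVmx.
rewrite /= (_ : row_mx _ _ = A' *m R^c) /row_free ?mxrankMfree ?row_free_unit //.
by rewrite /dlsubmx /drsubmx hsubmxK SA mul_col_mx col_mxKd.
Qed.

Lemma pair_iso_rank P Q : pair_iso P Q ->
  pair_rows P = pair_rows Q /\ \rank (pair_fst P) = \rank (pair_fst Q).
Proof.
move=> PQ; suff le P' Q' : pair_iso P' Q' ->
    (pair_rows P' <= pair_rows Q')%N /\ (\rank (pair_fst Q') <= \rank (pair_fst P'))%N.
  have [rPQ kQP] := le _ _ PQ; have [rQP kPQ] := le _ _ (pair_iso_sym PQ).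
  by split; apply/eqP; rewrite eqn_leq ?rPQ ?rQP ?kPQ ?kQP.
case=> S [S' [R [R' [[SS SS'] _ <- _]]]]; rewrite (mulmx1_min SS'); split=> //.
by apply: leq_trans (mxrankM_maxl _ _) (mxrankM_maxr _ _).
Qed.

(** These are the sources of nonnegativity. [k] is the row defect of the first matrix; that of [Q]
    is at most [l] because the [l] columns of [X] make up for it; and [l <= k] by the independent
    columns of [B]. *)
Lemma iso_step_rank P k l Q : iso_step P k l Q ->
  [/\ (k + \rank (pair_fst P))%N = pair_rows P,
      (pair_rows Q <= l + \rank (pair_fst Q))%N & (l <= k)%N].
Proof.
case=> X [Y [B [/pair_iso_rank[/= eP ->] X_free B_free]]].
rewrite eP block_mxEv row_mx0 rank_col_0mx (eqP X_free); split=> //.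
  rewrite -{1}(eqP X_free) (_ : row_mx X _ = row_mx X 0 + row_mx 0 (pair_fst Q)).
    apply: leq_trans (mxrank_add _ _) _.
    by rewrite rank_row_mx0 rank_row_0mx leq_add2r rank_leq_col.
  by rewrite add_row_mx !mxsimp.
by rewrite -(eqP B_free) rank_leq_col.
Qed.

(** The half of the decomposition that steps consume; [Z] collects the rest. *)
Definition decomp_step (f j : seq nat) Z : mxpair C :=
  dsum (dsum_mults (fun i => FG C i.+1) f) (dsum (dsum_mults (fun i => JI C i.+1) j) Z).

Lemma sumn_nth (f : seq nat) : (\sum_(0 <= i < size f) nth 0 f i * 1)%N = sumn f.
Proof. by rewrite sumnE [RHS](big_nth 0%N); apply: eq_bigr => i _; rewrite muln1. Qed.

Lemma sumn_behead_nth (f : seq nat) :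
  (\sum_(0 <= i < size f) nth 0 f i * (0 < i))%N = sumn (behead f).
Proof.
case: f => [|x f]; first by rewrite big_geq.
by rewrite /= big_nat_recl //= muln0 add0n sumn_nth.
Qed.

(** Each block loses one row, and one column unless it is (F_1, G_1); [Z] contributes the trivial
    step. *)
Lemma iso_step_decomp f j Z : row_free (pair_fst Z) ->
  iso_step (decomp_step f j Z) (sumn f + sumn j) (sumn (behead f) + sumn j)
    (decomp_step (behead f) (behead j) Z).
Proof.
move=> Z_free.
have Ff : iso_step (dsum_mults (fun i => FG C i.+1) f) (sumn f) (sumn (behead f))
    (dsum_mults (fun i => FG C i.+1) (behead f)).
  apply: (iso_step_isor (dsum_mults_head0 f (FG0 C))).
  by rewrite -sumn_nth -sumn_behead_nth; apply/iso_step_mults/iso_step_FG.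
have Jj : iso_step (dsum_mults (fun i => JI C i.+1) j) (sumn j) (sumn j)
    (dsum_mults (fun i => JI C i.+1) (behead j)).
  apply: (iso_step_isor (dsum_mults_head0 j (JI0 C))).
  by rewrite -sumn_nth; apply/iso_step_mults/iso_step_JI.
rewrite -[sumn j in X in iso_step _ X _]addn0 -[sumn j in X in iso_step _ _ X]addn0.
apply: iso_step_dsum Ff (iso_step_dsum Jj (iso_step_refl Z_free)).
Qed.

Lemma pair_iso_decomp0 f j Z : sumn f = 0%N -> sumn j = 0%N -> pair_iso (decomp_step f j Z) Z.
Proof.
move=> f0 j0; apply: pair_iso_trans (pair_iso0l Z); apply: pair_iso_dsum.
  exact: dsum_mults_eq0.
apply: pair_iso_trans (pair_iso0l Z); apply: pair_iso_dsum (pair_iso_refl _).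
exact: dsum_mults_eq0.
Qed.

Lemma F_mults_cons kl s : F_mults (kl :: s) = (kl.1 - kl.2)%N :: F_mults s.
Proof.
(* The shift of indices is valid only from 1 on, because of the truncated predecessor in [out_k]. *)
rewrite /F_mults /=; congr cons; rewrite -[2%N]/(1 + 1)%N iotaDl -map_comp.
by apply/eq_in_map => -[|i] //; rewrite mem_iota.
Qed.

(** For empty [s] the default value 0 of [out_k s 1] gives the last multiplicity l_t. *)
Lemma J_mults_cons kl s : J_mults (kl :: s) = (kl.2 - out_k s 1)%N :: J_mults s.
Proof.
rewrite /J_mults /=; congr cons; rewrite -[2%N]/(1 + 1)%N iotaDl -map_comp.
by apply/eq_in_map => -[|i] //; rewrite mem_iota.
Qed.

(** The last two conclusions carry the induction: the telescoping sum matches the sizes of the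
    actual step with those of the step on the decomposition, and the row defect bounds the next
    k. *)
Lemma reduction_decomp P s Q : reduction P s Q ->
  [/\ pair_iso P (decomp_step (F_mults s) (J_mults s) Q), row_free (pair_fst Q),
      mults_nonneg s, out_k s 1 = (sumn (F_mults s) + sumn (J_mults s))%N
    & (out_k s 1 + \rank (pair_fst P))%N = pair_rows P].
Proof.
elim=> {P s Q} [P P_free|P [k l] P1 s Q /red_step_iso[_ PP1] _ [IH Q_free nneg eK eR]].
  split=> //; first by apply/pair_iso_sym/pair_iso_decomp0.
  - by move=> i /andP[i1 i0]; have := leq_trans i1 i0.
  - by rewrite /out_k /= (eqP P_free).
rewrite /= in PP1; have [rP rP1 lk] := iso_step_rank PP1.
have k2l : (out_k s 1 <= l)%N by rewrite -(leq_add2r (\rank (pair_fst P1))) eR.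
rewrite F_mults_cons J_mults_cons /=; split=> //.
- have := iso_step_decomp (k - l :: F_mults s)%N (l - out_k s 1 :: J_mults s)%N Q_free.
  (* With [eK] the sums telescope to [k] and [l]; the inequalities [lk] and [k2l] make the
     subtractions exact. *)
  rewrite [sumn _]/= [sumn (_ :: _)]/= /behead (_ : (_ + _)%N = k); last by lia.
  rewrite (_ : (_ + (_ + _))%N = l); last by lia.
  by move=> DD1; apply: iso_step_lift PP1 DD1 IH.
- by case=> [|[|i]] //= lti; apply: (nneg i.+1).
- by rewrite -[LHS]/k; lia.
Qed.

Lemma sumn_eq0_nth f i : sumn f = 0%N -> nth 0%N f i = 0%N.
Proof.
elim: f i => [|x f IHf] [|i] //= /eqP; rewrite addn_eq0 => /andP[/eqP x0 /eqP f0] //.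
exact: IHf.
Qed.

(** By [iso_step_det] each step of the run agrees with the step on the given decomposition. The
    tails are then determined by induction and the heads by differences of sizes; the last
    conclusion supplies the next k, needed for the head of [j]. *)
Lemma reduction_uniq P s Q : reduction P s Q ->
  forall f j Z, row_free (pair_fst Z) -> pair_iso P (decomp_step f j Z) ->
  [/\ same_mults f (F_mults s), same_mults j (J_mults s), pair_iso Q Z
    & out_k s 1 = (sumn f + sumn j)%N].
Proof.
elim=> {P s Q} [P P_free|P [k l] P1 s Q /red_step_iso[_ PP1] _ IH] f j Z Z_free PD.
  (* Comparison with the trivial step makes all multiplicities vanish. *)
  have [/esym/eqP] := iso_step_det (iso_step_refl P_free) (iso_step_decomp f j Z_free) PD.
  rewrite addn_eq0 => /andP[/eqP f0 /eqP j0] _ _; split.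
  - by move=> i; rewrite sumn_eq0_nth ?nth_nil.
  - by move=> i; rewrite sumn_eq0_nth ?nth_nil.
  - by apply: pair_iso_trans PD _; apply: pair_iso_decomp0.
  - by rewrite f0 j0.
rewrite /= in PP1; have [ek el P1D] := iso_step_det PP1 (iso_step_decomp f j Z_free) PD.
have [ef ej QZ eK] := IH _ _ _ Z_free P1D.
have sumn_head (g : seq nat) : sumn g = (nth 0 g 0 + sumn (behead g))%N by case: g.
rewrite F_mults_cons J_mults_cons /=; split=> //.
- case=> [|i] /=; last by rewrite -ef nth_behead.
  by rewrite ek el (sumn_head f); lia.
- case=> [|i] /=; last by rewrite -ej nth_behead.
  by rewrite el eK (sumn_head j); lia.
Qed.

(** The second matrix is block lower triangular, so independence of its columns passes to its lower
    right block. Thus the second run preserves what the first one achieved. *)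
Lemma iso_step_dual_free P k l Q : iso_step P k l Q ->
  row_free (pair_fst (dual_pair P)) -> row_free (pair_fst (dual_pair Q)).
Proof.
case=> X [Y [B [/pair_iso_dual PX _ _]]] /(row_free_iso PX) /row_freeP[D] /=.
rewrite tr_block_mx trmx0 -[D]submxK mulmx_block !mxsimp scalar_mx_block.
by move=> /eq_block_mx[_ _ _ QD]; apply/row_freeP; exists (drsubmx D).
Qed.

Lemma reduction_dual_free P s Q : reduction P s Q ->
  row_free (pair_fst (dual_pair P)) -> row_free (pair_fst (dual_pair Q)).
Proof.
elim=> {P s Q} // P kl P1 s Q /red_step_iso[_ PP1] _ IH P_free.
exact/IH/(iso_step_dual_free PP1).
Qed.

End Reductions.

(** * The transposed half of the decomposition, obtained by duality *)

Section Duality.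
Variable C : numClosedFieldType.
Implicit Types P Q T : mxpair C.

Lemma undual_pairK : cancel (@undual_pair C) (@dual_pair C).
Proof.
case=> m n A B; rewrite /dual_pair /= trmxK; congr MxPair.
by apply/matrixP=> i j; rewrite !mxE conjCK.
Qed.

Definition decomp_dual (ft jt : seq nat) T : mxpair C :=
  dsum (dsum_mults (fun i => FGt C i.+1) ft) (dsum (dsum_mults (fun i => IJ C i.+1) jt) T).

Lemma dual_decomp_dual ft jt T :
  pair_iso (dual_pair (decomp_dual ft jt T)) (decomp_step ft jt (dual_pair T)).
Proof.
rewrite !dual_pair_dsum !dual_pair_mults; apply: pair_iso_dsum.
  by apply: pair_iso_mults => i; apply: pair_iso_dual_FGt.
apply: pair_iso_dsum (pair_iso_refl _).
by apply: pair_iso_mults => i; apply: pair_iso_dual_IJ.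
Qed.

(** This qualifies the transposed half as the remainder [Z] on which steps act trivially. *)
Lemma row_free_decomp_dual ft jt T :
  row_free (pair_fst T) -> row_free (pair_fst (decomp_dual ft jt T)).
Proof.
move=> T_free; apply: row_free_dsum; first by apply: row_free_mults => i; apply: row_free_FGt.
apply: row_free_dsum T_free; apply: row_free_mults => i.
by rewrite row_free_unit unitmx1.
Qed.

Lemma pair_iso_undual_decomp P ft jt T :
  pair_iso (dual_pair P) (decomp_step ft jt T) -> pair_iso P (decomp_dual ft jt (undual_pair T)).
Proof.
move=> PD; rewrite -[P]dual_pairK -[decomp_dual _ _ _]dual_pairK; apply: pair_iso_undual.
by apply: pair_iso_trans PD (pair_iso_sym _); rewrite -{2}[T]undual_pairK; apply: dual_decomp_dual.
Qed.

(** Independent rows of one matrix and independent columns of the other, of the same size, force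
    both to be square. *)
Lemma nonsingular_undual Q : row_free (pair_fst Q) -> row_free (pair_fst (dual_pair Q)) ->
  nonsingular_pair (undual_pair Q).
Proof.
case: Q => m n A B /= A_free B_free.
have emn : m = n.
  have mn := rank_leq_col A; have nm := rank_leq_col B^T.
  by apply/eqP; rewrite eqn_leq -{1}(eqP A_free) mn -{1}(eqP B_free).
subst n; exists m, (B ^t*), A^T; split=> //.
  by rewrite map_unitmx -row_free_unit.
by rewrite unitmx_tr -row_free_unit.
Qed.

End Duality.

Theorem theorem5 (R : realType) (m n : nat) (A B : 'M[R[i]]_(m, n)) :
  (exists s P st Q,
     reduction (MxPair A B) s P /\ reduction (dual_pair P) st Q) /\
  (forall (s : seq (nat * nat)) (P : mxpair R[i])
          (st : seq (nat * nat)) (Q : mxpair R[i]),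
     reduction (MxPair A B) s P ->
     reduction (dual_pair P) st Q ->
     [/\ mults_nonneg s /\ mults_nonneg st,
         mixed_equiv (MxPair A B)
           (decomposition (F_mults s) (J_mults s) (F_mults st) (J_mults st)
              (undual_pair Q)),
         nonsingular_pair (undual_pair Q)
       & forall (f j ft jt : seq nat) (P' : mxpair R[i]),
           nonsingular_pair P' ->
           mixed_equiv (MxPair A B) (decomposition f j ft jt P') ->
           [/\ same_mults f (F_mults s), same_mults j (J_mults s),
               same_mults ft (F_mults st), same_mults jt (J_mults st)
             & mixed_equiv P' (undual_pair Q)]]).
Proof.
split.
  have [s [P redP]] := reduction_exists (MxPair A B).
  by have [st [Q redQ]] := reduction_exists (dual_pair P); exists s, P, st, Q.
move=> s P st Q redP redQ.
have [isoP P_free nnegs _ _] := reduction_decomp redP.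
have [isoQ Q_free nnegst _ _] := reduction_decomp redQ.
split=> //.
- apply: pair_iso_mixed; apply: pair_iso_trans isoP _.
  apply: pair_iso_dsum (pair_iso_refl _) (pair_iso_dsum (pair_iso_refl _) _).
  exact: pair_iso_undual_decomp isoQ.
- apply: nonsingular_undual => //; apply: reduction_dual_free redQ _.
  (* The double dual conjugates the first matrix of [P] entrywise, which preserves its rank. *)
  by rewrite /= map_trmx trmxK /row_free mxrank_map.
move=> f j ft jt P' P'_nonsing /mixed_pair_iso isoD.
have [P'_free P'd_free] : row_free (pair_fst P') /\ row_free (pair_fst (dual_pair P')).
  case: P'_nonsing => p [A' [B' [-> uA uB]]].
  by rewrite !row_free_unit unitmx_tr.
(* Uniqueness is applied twice: first with the whole transposed half as remainder, then to the dual
   of that remainder. *)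
have [ef ej PZ _] := reduction_uniq redP (row_free_decomp_dual ft jt P'_free) isoD.
have dualPD := pair_iso_trans (pair_iso_dual PZ) (dual_decomp_dual ft jt P').
have [eft ejt QP' _] := reduction_uniq redQ P'd_free dualPD.
split=> //; apply: pair_iso_mixed; apply: pair_iso_sym.
by rewrite -[P']dual_pairK; apply: pair_iso_undual.
Qed.
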